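(* Let $\mathcal{F}=\{f_{n}\}_{n\in\mathbb{N}}$ be a uniformly contracting time varying map on a metric space $(X,d)$. Then: (a) $\mathcal{F}$ has the shadowing property; (b) $\mathcal{F}$ has the limit shadowing property; (c) $\mathcal{F}$ has the exponential limit shadowing property; (d) $\mathcal{F}$ has the s-limit shadowing property.
   Context: $\mathbb{N}=\{1,2,3,\dots\}$. A time varying map on a metric space $(X,d)$ is a sequence $\mathcal{F}=\{f_n\}_{n\in\mathbb{N}}$ of continuous maps $f_n:X\to X$. Put $\mathcal{F}_n:=f_n\circ f_{n-1}\circ\cdots\circ f_1$ for $n\ge 1$ and $\mathcal{F}_0:=\mathrm{Id}_X$. Uniformly contracting: the contracting ratio $\alpha:=\sup_{n\in\mathbb{N}}\sup_{x,y\in X,\,x\ne y}\frac{d(f_n(x),f_n(y))}{d(x,y)}$ exists and is less than one. For $\delta>0$, a sequence $\{x_n\}_{n\ge 0}$ in $X$ is a $\delta$-pseudo orbit of $\mathcal{F}$ if $d(f_{n+1}(x_n),x_{n+1})<\delta$ for all $n\ge 0$. It is a limit pseudo orbit if $d(f_{n+1}(x_n),x_{n+1})\to 0$ as $n\to+\infty$. For a real sequence $\{a_n\}_{n\ge0}$ and $\theta\in(0,1)$ write $a_n\xrightarrow{\theta}0$ if there is $L>0$ with $|a_n|\le L\theta^n$ for all $n\ge0$; $\{x_n\}_{n\ge0}$ is a $\theta$-exponentially limit pseudo orbit if $d(f_{n+1}(x_n),x_{n+1})\xrightarrow{\theta}0$. Shadowing property: for every $\varepsilon>0$ there is $\delta>0$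 such that for every $\delta$-pseudo orbit $\{x_n\}_{n\ge0}$ in $X$ there is $x\in X$ with $d(\mathcal{F}_n(x),x_n)<\varepsilon$ for all $n\ge0$. Limit shadowing property: for every limit pseudo orbit $\{x_n\}_{n\ge0}$ in $X$ there is $x\in X$ with $d(\mathcal{F}_n(x),x_n)\to 0$ as $n\to+\infty$. Exponential limit shadowing property: there exists $\theta_0\in(0,1)$ such that for every $\theta\in(\theta_0,1)$ and every $\theta$-exponentially limit pseudo orbit $\{x_n\}_{n\ge0}$ in $X$ there is $x\in X$ with $d(\mathcal{F}_n(x),x_n)\xrightarrow{\theta}0$. s-limit shadowing property: for every $\varepsilon>0$ there is $\delta>0$ such that (1) for every $\delta$-pseudo orbit $\{x_n\}_{n\ge0}$ in $X$ there exists $x\in X$ with $d(\mathcal{F}_n(x),x_n)<\varepsilon$ for all $n\ge 0$, and (2) if in addition $\{x_n\}_{n\ge0}$ is a limit pseudo orbit, then (this $x$ can be taken so that) $d(\mathcal{F}_n(x),x_n)\to0$ as $n\to+\infty$. *)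

(* Defs.v *)
From mathcomp Require Import all_boot all_order all_algebra.
From mathcomp Require Import all_classical all_reals all_analysis.

Set Implicit Arguments.
Unset Strict Implicit.
Unset Printing Implicit Defensive.

Import Order.TTheory GRing.Theory Num.Theory.
Import numFieldNormedType.Exports.

Local Open Scope classical_set_scope.
Local Open Scope ring_scope.

(* Index shift: a time varying map f_1, f_2, ... is encoded as a sequence of
   maps f : nat -> X -> X in which [f n] is the map f_{n+1}. *)
Section TimeVaryingMap.
Context {R : realType} {X : metricType R}.
Implicit Types (f : nat -> X -> X) (u : nat -> X) (x : X).

(* f_n o ... o f_1, and the identity for n = 0. *)
Fixpoint time_iter f (n : nat) : X -> X :=
  if n is m.+1 then f m \o time_iter f m else id.

(* The suprema are taken in the extended reals, so the ratio is +oo when it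
   does not exist as a real, and -oo when X has at most one point. *)
Definition contracting_ratio f : \bar R :=
  ereal_sup [set ereal_sup [set (mdist (f n p.1) (f n p.2)
                                  / mdist p.1 p.2)%:E
                           | p in [set p : X * X | p.1 <> p.2]]
            | n in [set: nat]].

Definition uniformly_contracting f : Prop := (contracting_ratio f < 1%:E)%E.

Definition pseudo_orbit f (delta : R) u : Prop :=
  forall n, mdist (f n (u n)) (u n.+1) < delta.

Definition limit_pseudo_orbit f u : Prop :=
  mdist (f n (u n)) (u n.+1) @[n --> \oo] --> (0 : R).

Definition exp_cvg0 (theta : R) (a : nat -> R) : Prop :=
  exists L : R, 0 < L /\ forall n, `|a n| <= L * theta ^+ n.

Definition exp_limit_pseudo_orbit f (theta : R) u : Prop :=
  exp_cvg0 theta (fun n => mdist (f n (u n)) (u n.+1)).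

Definition shadows f (eps : R) x u : Prop :=
  forall n, mdist (time_iter f n x) (u n) < eps.

Definition limit_shadows f x u : Prop :=
  mdist (time_iter f n x) (u n) @[n --> \oo] --> (0 : R).

Definition exp_limit_shadows f (theta : R) x u : Prop :=
  exp_cvg0 theta (fun n => mdist (time_iter f n x) (u n)).

Definition shadowing_property f : Prop :=
  forall eps : R, 0 < eps -> exists delta : R, 0 < delta /\
    forall u, pseudo_orbit f delta u -> exists x, shadows f eps x u.

Definition limit_shadowing_property f : Prop :=
  forall u, limit_pseudo_orbit f u -> exists x, limit_shadows f x u.

Definition exp_limit_shadowing_property f : Prop :=
  exists theta0 : R, (0 < theta0 < 1) /\
    forall theta : R, theta0 < theta < 1 ->
    forall u, exp_limit_pseudo_orbit f theta u ->
      exists x, exp_limit_shadows f theta x u.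

Definition s_limit_shadowing_property f : Prop :=
  forall eps : R, 0 < eps -> exists delta : R, 0 < delta /\
    (forall u, pseudo_orbit f delta u -> exists x, shadows f eps x u) /\
    (forall u, pseudo_orbit f delta u -> limit_pseudo_orbit f u ->
       exists x, shadows f eps x u /\ limit_shadows f x u).

End TimeVaryingMap.

(* Main.v *)
Require Import Defs.
From mathcomp Require Import all_boot all_order all_algebra.
From mathcomp Require Import all_classical all_reals all_analysis.
From mathcomp Require Import ring lra.

(** The initial point of a pseudo orbit always shadows it. If [k < 1] is a
    common Lipschitz constant of the maps, the shadowing errors [a n] and the
    jumps [e n] satisfy [a 0 = 0] and [a n.+1 <= k * a n + e n], and each of the
    four properties is a statement about this scalar recursion. *)

Set Implicit Arguments.
Unset Strict Implicit.
Unset Printing Implicit Defensive.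

Import Order.TTheory GRing.Theory Num.Theory.
Import numFieldNormedType.Exports.

Local Open Scope classical_set_scope.
Local Open Scope ring_scope.

Section ContractiveRecursion.
Context {R : realType} (k : R) (a e : nat -> R).
Hypotheses (k0 : 0 < k) (k1 : k < 1).
Hypothesis a_rec : forall n, a n.+1 <= k * a n + e n.

(** The level [c] is the fixed point of [s |-> k * s + (1 - k) * c], so the recursion cannot cross
    it; strictness survives each step because [k] is positive. *)
Lemma contractive_rec_lt c : a 0%N < c -> (forall n, e n <= (1 - k) * c) ->
  forall n, a n < c.
Proof.
move=> a0 ec; elim=> // n; rewrite -(ltr_pM2l k0) => IH.
by have := a_rec n; have := ec n; lra.
Qed.

(** The constant [C = L / (t - k)] solves [C * t = k * C + L], so [C * t ^+ n] satisfies the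
    recursion with equality for the jumps [L * t ^+ n]. *)
Lemma contractive_rec_le_geometric t L : a 0%N <= 0 -> 0 < L -> k < t ->
  (forall n, e n <= L * t ^+ n) -> forall n, a n <= L / (t - k) * t ^+ n.
Proof.
move=> a0 L0 kt eL.
have tk : 0 < t - k by lra.
elim=> [|n IH].
  by rewrite expr0 mulr1; apply: (le_trans a0); rewrite ltW// divr_gt0.
have -> : L / (t - k) * t ^+ n.+1 = k * (L / (t - k) * t ^+ n) + L * t ^+ n.
  by rewrite exprS; field; rewrite gt_eqF.
by apply: (le_trans (a_rec n)); apply: lerD => //; rewrite ler_pM2l.
Qed.

Lemma contractive_rec_cvg0 : (forall n, 0 <= a n) ->
  e n @[n --> \oo] --> (0 : R) -> a n @[n --> \oo] --> (0 : R).
Proof.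
move=> a_ge0 e0; apply/cvgrPdist_lt => eps eps0.
have d0 : 0 < (1 - k) * (eps / 2) by rewrite mulr_gt0 ?subr_gt0 ?divr_gt0.
move/cvgrPdist_lt : e0 => /(_ _ d0)[N _ eN].
(* Beyond [N] the jumps are at most [(1 - k) * (eps / 2)], so the excess of the error over [eps / 2]
   is multiplied by at most [k] at each step. *)
have aN m : a (N + m)%N <= eps / 2 + k ^+ m * a N.
  elim: m => [|m IH]; first by rewrite addn0 expr0; lra.
  have /= := eN (N + m)%N (leq_addr m N); rewrite sub0r normrN => /ltr_normlW eNm.
  rewrite addnS exprS; move: IH; rewrite -(ler_pM2l k0) mulrDr mulrA.
  by have := a_rec (N + m)%N; lra.
have kN : k ^+ m * a N @[m --> \oo] --> (0 : R).
  rewrite -(mul0r (a N)); apply: cvgMl; apply: cvg_expr.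
  by rewrite ger0_norm// ltW.
have e20 : 0 < eps / 2 by lra.
move/cvgrPdist_lt : kN => /(_ _ e20)[M _ kM].
(* [N] steps make the jumps small, and [M] more bring the term [k ^+ m * a N] below [eps / 2]. *)
exists (N + M)%N => // n /= NMn.
have Nn : (N <= n)%N by apply: leq_trans NMn; exact: leq_addr.
have /= := kM (n - N)%N; rewrite leq_subRL// => /(_ NMn).
rewrite !sub0r !normrN => /ltr_normlW kMn.
by rewrite ger0_norm//; have := aN (n - N)%N; rewrite subnKC//; lra.
Qed.

End ContractiveRecursion.

Section UniformlyContracting.
Context {R : realType} {X : metricType R}.
Implicit Types (f : nat -> X -> X) (u : nat -> X).

Lemma uniformly_contracting_lipschitz f : uniformly_contracting f ->
  exists2 k : R, 0 < k < 1 &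
    forall n x y, mdist (f n x) (f n y) <= k * mdist x y.
Proof.
rewrite /uniformly_contracting => f1.
have [k /andP[k0 k1] fk] :
    exists2 k : R, 0 < k < 1 & (contracting_ratio f <= k%:E)%E.
  (* The ratio may be [-oo] or [0]; the value [1 / 2] keeps [k] positive in these cases. *)
  case: (contracting_ratio f) f1 => [r| |] //= f1; last first.
    by exists (1 / 2); [clear f1; lra | exact: leNye].
  exists (Num.max r (1 / 2)); last by rewrite lee_fin le_max lexx.
  have {}f1 : r < 1 by rewrite -lte_fin.
  by rewrite lt_max gt_max f1; lra.
exists k; first by rewrite k0.
(* The supremum ranges over distinct points only, so [x = y] is treated apart. *)
move=> n x y; have [->|/eqP xy] := eqVneq x y.
  by rewrite !mdistxx mulr0.
have d0 : 0 < mdist x y by rewrite mdist_gt0; exact/eqP.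
rewrite -ler_pdivrMr// -lee_fin; apply: le_trans fk.
apply: (@le_trans _ _ (ereal_sup [set (mdist (f n p.1) (f n p.2)
    / mdist p.1 p.2)%:E | p in [set p : X * X | p.1 <> p.2]])).
  by apply: ereal_sup_ubound; exists (x, y).
by apply: ereal_sup_ubound; exists n.
Qed.

(** The triangle inequality through [f n (u n)] separates the contracted old error from the new
    jump. *)
Lemma mdist_time_iter_rec f u (k : R) :
  (forall n x y, mdist (f n x) (f n y) <= k * mdist x y) -> forall x n,
  mdist (time_iter f n.+1 x) (u n.+1) <=
    k * mdist (time_iter f n x) (u n) + mdist (f n (u n)) (u n.+1).
Proof.
move=> fk x n /=; apply: le_trans (metric_triangle _ (f n (u n)) _) _.
by rewrite lerD2r.
Qed.

End UniformlyContracting.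

Theorem theorem5p2 (R : realType) (X : metricType R) (f : nat -> X -> X)
  (f_continuous : forall n : nat, continuous (f n))
  (f_contracting : uniformly_contracting f) :
  shadowing_property f /\
  limit_shadowing_property f /\
  exp_limit_shadowing_property f /\
  s_limit_shadowing_property f.
Proof.
have [k /andP[k0 k1] fk] := uniformly_contracting_lipschitz f_contracting.
have u_rec u := mdist_time_iter_rec u fk (u 0%N).
have shadow (eps : R) u : 0 < eps -> pseudo_orbit f ((1 - k) * eps) u ->
    shadows f eps (u 0%N) u.
  move=> eps0 uf; apply: (contractive_rec_lt k0 (u_rec u)) => [|n].
    by rewrite /= mdistxx.
  exact/ltW/uf.
have limit u : limit_pseudo_orbit f u -> limit_shadows f (u 0%N) u.
  by apply: (contractive_rec_cvg0 k0 k1 (u_rec u)) => n; exact: mdist_ge0.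
have delta_gt0 (eps : R) : 0 < eps -> 0 < (1 - k) * eps.
  by move=> eps0; rewrite mulr_gt0// subr_gt0.
split; [|split; [|split]].
- move=> eps eps0; exists ((1 - k) * eps); split; first exact: delta_gt0.
  by move=> u /(shadow _ _ eps0); exists (u 0%N).
- by move=> u /limit; exists (u 0%N).
(* The threshold is [k] itself: a rate [t > k] decays more slowly than the contraction, which makes
   [t - k] a positive denominator. *)
- exists k; split=> [|t /andP[kt _] u [L [L0 uL]]]; first by rewrite k0.
  exists (u 0%N), (L / (t - k)); split; first by rewrite divr_gt0 ?subr_gt0.
  move=> n; rewrite ger0_norm ?mdist_ge0//.
  apply: (contractive_rec_le_geometric k0 (u_rec u)) => // [|m].
    by rewrite /= mdistxx.
  exact: le_trans (ler_norm _) (uL m).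
(* The same point [u 0] shadows in both senses, so the [delta] of plain shadowing suffices. *)
- move=> eps eps0; exists ((1 - k) * eps); split; first exact: delta_gt0.
  split=> u /(shadow _ _ eps0) su; first by exists (u 0%N).
  by move=> /limit lu; exists (u 0%N).
Qed.
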